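(* Let $\mu>0$. For each $n\ge 1$ let $Q_n$ be the number of customers in an $M/M/\infty$ queue with arrival rate $\lambda_n=n\mu$ and individual service rate $\mu$, where $Q_n(0)$ is independent of the arrival process and the service times. Suppose that $(Q_n(0)-n)/\sqrt n\Rightarrow X(0)$ in $\mathbb R$ as $n\to\infty$ for some real random variable $X(0)$. Let $\Psi_{S,n}(t)=Q_n(t)/n$, $t\ge0$. Then $$\Psi_{S,n}\Rightarrow\omega\quad\text{in }D\text{ as }n\to\infty,$$ where $\omega(t)=1$ for all $t\ge0$.
   Context: $D=D([0,\infty),\mathbb R)$ has the Skorohod $J_1$ topology; $\Rightarrow$ denotes convergence in distribution. In the $M/M/\infty$ model the number in system is a birth-and-death process on $\{0,1,2,\dots\}$ with birth rates $\lambda_k=\lambda$ and death rates $\mu_k=k\mu$; equivalently it may be constructed as the solution of $Q(t)=Q(0)+A(\lambda t)-S\left(\mu\int_0^tQ(s)\,ds\right)$ with $A,S$ independent rate-1 Poisson processes independent of $Q(0)$. *)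

(* Defs.v *)
From HB Require Import structures.
From mathcomp Require Import all_boot all_order all_algebra.
From mathcomp Require Import all_classical all_reals all_analysis.
Import Order.TTheory GRing.Theory Num.Theory.
Import numFieldNormedType.Exports.

Set Implicit Arguments.
Unset Strict Implicit.
Unset Printing Implicit Defensive.

Local Open Scope classical_set_scope.
Local Open Scope ring_scope.

(** * The space [D([0, oo), R)] *)

(* A path on [0, oo) is encoded as a function on the whole line that is
   constant, equal to its value at 0, on the negative half-line.  Equality of
   encodings is thus equality of paths, and the values at negative times carry
   no information. *)
Record cadlag (R : realType) (x : R -> R) : Prop := Cadlag {
  cadlag_right : forall t, 0 <= t -> x s @[s --> t^'+] --> x t ;
  cadlag_left : forall t, 0 < t -> cvg (x s @[s --> t^'-]) ;
  cadlag_neg : forall t, t < 0 -> x t = x 0 }.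

Record skorohod (R : realType) := Skorohod {
  skorohod_path :> R -> R ;
  skorohod_cadlag : cadlag skorohod_path }.

Section skorohod_constructions.
Context {R : realType}.

Lemma cadlag_cst (c : R) : cadlag (cst c).
Proof.
by split=> // t _; [exact: cvg_cst | apply/cvg_ex; exists c; exact: cvg_cst].
Qed.

Lemma cadlag_scale (c : R) (x : R -> R) :
  cadlag x -> cadlag (fun t => c * x t).
Proof.
move=> [xr xl xn]; split=> t t0; last by rewrite xn.
- by apply: cvgMl_tmp; exact: xr.
- by apply: is_cvgMl_tmp; exact: xl.
Qed.

Definition skorohod_cst (c : R) : skorohod R := Skorohod (cadlag_cst c).

Definition skorohod_scale (c : R) (x : skorohod R) : skorohod R :=
  Skorohod (cadlag_scale c (skorohod_cadlag x)).

End skorohod_constructions.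

HB.instance Definition _ (R : realType) := gen_eqMixin (skorohod R).
HB.instance Definition _ (R : realType) := gen_choiceMixin (skorohod R).
HB.instance Definition _ (R : realType) :=
  isPointed.Build (skorohod R) (skorohod_cst 0).

(** * The Skorohod J1 topology *)

Section J1.
Context {R : realType}.
Implicit Types (x y : skorohod R) (T e : R) (U : set (skorohod R)).

(* An increasing bijection of [0, oo) is automatically a homeomorphism
   fixing 0. *)
Definition time_change (lam : R -> R) : Prop :=
  set_bij `[0, +oo[ `[0, +oo[ lam /\
  (forall s t, 0 <= s -> s < t -> lam s < lam t).

Definition J1_near T e x : set (skorohod R) :=
  [set y | exists2 lam, time_change lam &
     forall s, 0 <= s <= T -> `|lam s - s| < e /\ `|y (lam s) - x s| < e].

(* The convergent sequences are those of J1 on a noncompact time interval: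
   [x_n --> x] iff for every [T] there are time changes [lam_n] such that both
   [sup_(s <= T) |lam_n s - s|] and [sup_(s <= T) |x_n (lam_n s) - x s|] tend
   to 0 (Ethier and Kurtz, Markov Processes, Proposition 3.5.3). *)
Definition J1_open U : Prop :=
  forall x, U x -> exists T e, 0 < e /\ J1_near T e x `<=` U.

Lemma J1_nearS T T' e e' x :
  T' <= T -> e <= e' -> J1_near T e x `<=` J1_near T' e' x.
Proof.
move=> TT' ee' y [lam lamP xy]; exists lam => // s /andP[s0 sT'].
have [|h1 h2] := xy s; first by rewrite s0 (le_trans sT').
by split; exact: lt_le_trans ee'.
Qed.

Lemma J1_openT : J1_open setT.
Proof. by move=> x _; exists 0, 1. Qed.

Lemma J1_openI : setI_closed J1_open.
Proof.
move=> U V oU oV x [Ux Vx].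
have [T [e [e0 TeU]]] := oU _ Ux; have [T' [e' [e'0 TeV]]] := oV _ Vx.
exists (Num.max T T'), (Num.min e e'); split; first by rewrite lt_min e0.
move=> y xy; split; [apply: TeU|apply: TeV]; apply: J1_nearS xy;
  by rewrite ?le_max ?ge_min lexx ?orbT.
Qed.

Lemma J1_open_bigU (I : Type) (F : I -> set (skorohod R)) :
  (forall i, J1_open (F i)) -> J1_open (\bigcup_i F i).
Proof.
move=> oF x [i _ Fix]; have [T [e [e0 TeF]]] := oF _ _ Fix.
by exists T, e; split=> // y /TeF Fiy; exists i.
Qed.

End J1.

HB.instance Definition _ (R : realType) :=
  isOpenTopological.Build (skorohod R)
    (@J1_openT R) (@J1_openI R) (@J1_open_bigU R).

(** * Convergence in distribution *)

Definition borel (T : ptopologicalType) := g_sigma_algebraType (@open T).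

Definition random_element d (Omega : measurableType d) (T : ptopologicalType)
    (X : Omega -> T) : Prop :=
  measurable_fun [set: Omega] (X : Omega -> borel T).

(* The random elements of the sequence need not be defined on the same
   probability space.  As convergence only concerns large indices, so does the
   measurability requirement. *)
Definition cvg_in_distribution (R : realType) (T : ptopologicalType)
    (d : nat -> measure_display) (Omega : forall n, measurableType (d n))
    (P : forall n, probability (Omega n) R) (X : forall n, Omega n -> T)
    (d' : measure_display) (Omega' : measurableType d')
    (P' : probability Omega' R) (Y : Omega' -> T) : Prop :=
  [/\ \forall n \near \oo, random_element (X n),
      random_element Y &
      forall f : T -> R, continuous f -> bounded_fun f ->
        ('E_(P n)[f \o X n])%E @[n --> \oo] --> ('E_P'[f \o Y])%E].

(** * Poisson processes and the M/M/oo queue *)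

Section queue.
Context {R : realType} {d : measure_display} {Omega : measurableType d}.
Variable P : probability Omega R.

Definition mutually_independent (I : eqType) (F : I -> set_system Omega) :
    Prop :=
  forall (J : seq I) (E : I -> set Omega),
    uniq J -> (forall i, i \in J -> F i (E i)) ->
    P (\big[setI/setT]_(i <- J) E i) = (\prod_(i <- J) P (E i))%E.

Definition sigma_var (X : Omega -> R) : set_system Omega :=
  preimage_set_system setT X measurable.

Definition sigma_process (N : Omega -> skorohod R) : set_system Omega :=
  <<s \bigcup_(t in `[0, +oo[) sigma_var (N ^~ t) >>.

Definition increment (N : Omega -> skorohod R) (s t : R) (w : Omega) : R :=
  N w t - N w s.

Record unit_poisson_process (N : Omega -> skorohod R) : Prop := {
  poisson_measurable :
    forall t, 0 <= t -> measurable_fun [set: Omega] (N ^~ t : Omega -> R) ;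
  poisson_start : forall w, N w 0 = 0 ;
  poisson_nat : forall w t, 0 <= t -> exists k : nat, N w t = k%:R ;
  poisson_ndecr : forall w s t, 0 <= s -> s <= t -> N w s <= N w t ;
  poisson_indep : forall t : nat -> R,
    0 <= t 0%N -> {homo t : i j / (i <= j)%N >-> i <= j} ->
    mutually_independent (fun i => sigma_var (increment N (t i) (t i.+1))) ;
  poisson_law : forall s t (k : nat), 0 <= s -> s < t ->
    P (increment N s t @^-1` [set k%:R]) = (poisson_pmf (t - s) k)%:E }.

(* Number in system of the M/M/oo queue with arrival rate [lambda] and
   individual service rate [mu], as the solution of
   [Q(t) = Q(0) + A(lambda t) - S(mu \int_0^t Q(s) ds)], where [A] and [S] are
   independent unit-rate Poisson processes independent of [Q(0)].  This is the
   birth-and-death process with birth rates [lambda] and death rates [k mu]. *)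
Definition MMoo_queue (lambda mu : R) (Q : Omega -> skorohod R) : Prop :=
  [/\ random_element Q,
      forall w t, 0 <= t -> exists k : nat, Q w t = k%:R &
      exists A S : Omega -> skorohod R,
      [/\ unit_poisson_process A,
          unit_poisson_process S,
          mutually_independent
            (tnth [tuple sigma_var (Q ^~ 0); sigma_process A; sigma_process S])
        & \forall w \ae P, forall t, 0 <= t ->
            Q w t = Q w 0 + A w (lambda * t)
              - S w (mu * \int[lebesgue_measure]_(s in `[0, t]) Q w s)]].

End queue.

(* Main.v *)
Require Import Defs.
From mathcomp Require Import all_boot all_order all_algebra.
From mathcomp Require Import all_classical all_reals all_analysis.
From mathcomp Require Import measurable_realfun ring lra.
Import Order.TTheory GRing.Theory Num.Theory.
Import numFieldNormedType.Exports.
Local Open Scope classical_set_scope.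
Local Open Scope ring_scope.

(* Dividing the equation of the queue by [n] gives
   [q(t) = q(0) + A(n mu t)/n - S(n mu \int_0^t q)/n].  By Chebyshev's inequality
   on a finite grid, and monotonicity of the paths between grid points,
   [A(n u)/n] and [S(n u)/n] are uniformly close to [u] on compact intervals with
   probability tending to 1, while [q(0)] is close to 1 because
   [(Q(0) - n)/sqrt n] is tight.  On this event [|q - 1|] satisfies
   [|q(t) - 1| <= 3 d + mu \int_0^t |q - 1|], whence Gronwall's inequality; the
   a priori bound [q(t) <= q(0) + A(n mu t)/n] keeps the argument of [S] in a
   fixed compact interval. *)

(** * Measurability of cadlag paths *)

(** [p n s] is the first point strictly to the right of [s] in the grid of mesh [1 / n.+1]. Each
    [x \o p n] is constant on countably many half-open cells, hence measurable, and right continuity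
    at [s] makes it converge pointwise to [x]. The [+ 1] after the floor keeps [p n s] different
    from [s], as a right limit requires. *)
Lemma right_continuous_measurable (R : realType) (x : R -> R) :
  (forall t, x s @[s --> t^'+] --> x t) -> measurable_fun [set: R] x.
Proof.
move=> xr.
pose p (n : nat) (s : R) : R := (Num.floor (n.+1%:R * s) + 1)%:~R / n.+1%:R.
apply: (@measurable_fun_cvg _ _ _ _ (fun n => x \o p n)) => [n|s _].
- move=> _ B mB; rewrite setTI.
  have -> : (x \o p n) @^-1` B = \bigcup_(k in [set: int])
     (`[k%:~R / n.+1%:R, (k + 1)%:~R / n.+1%:R[%classic `&`
       [set s | B (x ((k + 1)%:~R / n.+1%:R))]).
    apply/seteqP; split => [s Bs|s [k _] [/= + Bk]].
      exists (Num.floor (n.+1%:R * s)) => //; split => //=.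
      rewrite in_itv /= ler_pdivrMr// ltr_pdivlMr// [s * _]mulrC.
      by rewrite ge_floor lt_succ_floor.
    rewrite in_itv /= ler_pdivrMr// ltr_pdivlMr// [s * _]mulrC => sk.
    by rewrite /= /p (floor_def sk).
  apply: countable_bigcupT_measurable => // k.
  apply: measurableI => //.
  (* The condition does not involve [s], so the set is full or empty. *)
  have [Bx|nBx] := pselect (B (x ((k + 1)%:~R / n.+1%:R))).
    rewrite (_ : [set s | _] = setT)//; by apply/seteqP; split.
  rewrite (_ : [set s | _] = set0)//; by apply/seteqP; split.
- have/cvg_at_rightP := xr s; apply; split=> [n|].
    by rewrite ltr_pdivlMr// mulrC lt_succ_floor.
  apply: (@squeeze_cvgr _ _ _ _ (fun n => s) (fun n => s + harmonic n)).
  + apply: nearW => n; rewrite ler_pdivlMr// ltW 1?mulrC ?lt_succ_floor//=.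
    by rewrite ler_pdivrMr// mulrDl /harmonic mulVf// intrD lerD2r mulrC ge_floor.
  + exact: cvg_cst.
  + rewrite -[X in _ --> X]addr0; apply: cvgD; first exact: cvg_cst.
    exact: cvg_harmonic.
Qed.

Lemma cadlag_measurable (R : realType) (x : R -> R) :
  cadlag x -> measurable_fun [set: R] x.
Proof.
move=> [xr _ xn]; apply: right_continuous_measurable => t.
have [t0|t0] := leP 0 t; first exact: xr.
(* At a negative time right continuity comes from the encoding: the path is constant near [t]. *)
apply: cvg_at_right_filter; rewrite (xn _ t0).
apply: cvg_near_cst.
by near=> s; rewrite xn//; near: s; exact: lt_nbhsl.
Unshelve. all: by end_near. Qed.

(** * Gronwall's inequality and the pathwise estimate *)

Lemma Rintegral_expR (R : realType) (c t : R) : 0 <= t ->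
  \int[lebesgue_measure]_(s in `[0, t]) (c * expR (c * s)) = expR (c * t) - 1.
Proof.
rewrite le_eqVlt => /predU1P[<-|t0].
  by rewrite set_itv1 Rintegral_set1 mulr0 expR0 subrr.
have dF (s : R) : is_derive s 1 (fun s => expR (c * s)) (c * expR (c * s)).
  have dc : is_derive s 1 (fun s : R => c * s) c.
    by apply: is_derive_eq; rewrite /GRing.scale /= mulr1.
  by rewrite mulrC; exact: (is_derive1_comp (is_derive_expR (c * s)) dc).
have cF : continuous (fun s => expR (c * s)).
  by move=> s; apply: differentiable_continuous; apply/derivable1_diffP; case: (dF s).
rewrite /Rintegral (@continuous_FTC2 _ _ (fun s => expR (c * s)))//=.
- by rewrite mulr0 expR0.
- by apply: continuous_subspaceT => s; apply: cvgMl_tmp; exact: cF.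
- split; first by move=> s _; case: (dF s).
  + by apply: cvg_at_right_filter; exact: cF.
  + by apply: cvg_at_left_filter; exact: cF.
- by move=> s _; rewrite derive1E; case: (dF s).
Qed.

(* For [M := sup (g t / E t)] with [E t := expR (2 mu t)], integrating
   [g <= M E] gives [M <= a + M / 2]. *)
Lemma gronwall (R : realType) (mu a b T : R) (g : R -> R) :
  0 < mu -> 0 <= a -> measurable_fun [set: R] g ->
  (forall t, 0 <= t <= T -> 0 <= g t <= b) ->
  (forall t, 0 <= t <= T ->
    g t <= a + mu * \int[lebesgue_measure]_(s in `[0, t]) g s) ->
  forall t, 0 <= t <= T -> g t <= 2 * a * expR (2 * mu * t).
Proof.
move=> mu0 a0 mg gb gI.
pose E t := expR (2 * mu * t).
have E0 t : 0 < E t by exact: expR_gt0.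
have E1 t : 0 <= t -> 1 <= E t.
  by move=> t0; rewrite -expR0 ler_expR !mulr_ge0// ltW.
pose B := [set g s / E s | s in [set s | 0 <= s <= T]].
have BP : forall t, 0 <= t <= T -> g t <= sup B * E t.
  move=> t tT; rewrite -ler_pdivrMr//; apply: ub_le_sup; last by exists t.
  (* The a priori bound [b] on [g], with [E >= 1], bounds [B] above, so that [sup B] is a true
     supremum. *)
  exists b => _ [s sT <-]; rewrite ler_pdivrMr//.
  have /andP[g0 gb'] := gb _ sT; have /andP[s0 _] := sT.
  by rewrite (le_trans gb')// ler_peMr ?E1// (le_trans g0).
move=> t tT; have /andP[t0 tT'] := tT.
have T0 : (0 : R) <= 0 <= T by rewrite lexx (le_trans t0).
have M0 : 0 <= sup B.
  have := BP _ T0; rewrite /E mulr0 expR0 mulr1; apply: le_trans.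
  by have /andP[] := gb _ T0.
suff M2a : sup B <= 2 * a by rewrite (le_trans (BP _ tT))// ler_wpM2r// ltW.
suff : sup B <= a + sup B / 2 by lra.
apply: ge_sup; first by exists (g 0 / E 0); exists 0.
move=> _ [s /= sT <-]; rewrite ler_pdivrMr//; have /andP[s0 sT'] := sT.
apply: le_trans (gI _ sT) _.
have ims : measurable `[0, s]%classic by [].
have les : (lebesgue_measure (`[0%R, s]%classic : set R) < +oo)%E.
  by rewrite lebesgue_measure_itv/=; case: ifPn => // _; rewrite -EFinD ltry.
have sub u : `[0, s]%classic u -> 0 <= u <= T.
  by rewrite /= in_itv/= => /andP[-> us]; rewrite (le_trans us).
have iZ k : lebesgue_measure.-integrable `[0, s] (EFin \o (fun u => k * E u)).
  apply: continuous_compact_integrable; first exact: segment_compact.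
  apply: continuous_subspaceT => u; apply: cvgMl_tmp.
  apply: continuous_comp; last exact: continuous_expR.
  by apply: cvgMl_tmp; exact: cvg_id.
(* The majorant is [sup B * E u], written as a multiple of the derivative of [E] so that
   [Rintegral_expR] evaluates it. *)
have : \int[lebesgue_measure]_(u in `[0, s]) g u <=
       \int[lebesgue_measure]_(u in `[0, s]) (sup B / (2 * mu) * (2 * mu * E u)).
  apply: le_Rintegral => //.
  - apply: measurable_bounded_integrable => //; first exact: measurable_funTS.
    exists b; split; first by rewrite num_real.
    move=> c bc u /= /sub /gb /andP[g0 gb']; rewrite ger0_norm// (le_trans gb')//.
    exact: ltW.
  - rewrite (_ : EFin \o _ = EFin \o (fun u => sup B * E u)).
      exact: iZ.
    by apply/funext => u /=; congr EFin; field; lra.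
  - move=> u /sub uT; rewrite (le_trans (BP _ uT))//.
    by rewrite mulrA mulrVK ?lexx// unitfE; lra.
rewrite RintegralZl// Rintegral_expR// -/(E s) => h.
rewrite mulrDl lerD ?ler_peMr ?E1//.
have := ler_wpM2l (ltW mu0) h.
rewrite (_ : mu * (_ / _ * _) = sup B / 2 * (E s - 1)); last by field; lra.
move/le_trans; apply; rewrite ler_wpM2l ?divr_ge0//; lra.
Qed.

(** The initial value, [A] and [S] each contribute an error of at most [d], so [gronwall] applies
    with [a = 3 * d], and its factor 2 gives the 6. The range required of [S] is [mu * T] times the
    a priori bound [mu * T + 3] on [Q / N]. *)
Lemma fluid_deviation (R : realType) (mu T d N : R) (Q A S : R -> R) :
  0 < mu -> 0 <= d <= 1 -> 0 < N -> measurable_fun [set: R] Q ->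
  (forall t, 0 <= t -> 0 <= Q t) -> (forall u, 0 <= u -> 0 <= S u) ->
  (forall t, 0 <= t -> Q t = Q 0 + A (N * mu * t)
     - S (mu * \int[lebesgue_measure]_(s in `[0, t]) Q s)) ->
  `|Q 0 / N - 1| <= d ->
  (forall u, 0 <= u <= mu * T -> `|A (N * u) / N - u| <= d) ->
  (forall u, 0 <= u <= mu * T * (mu * T + 3) -> `|S (N * u) / N - u| <= d) ->
  forall t, 0 <= t <= T -> `|Q t / N - 1| <= 6 * d * expR (2 * mu * T).
Proof.
move=> mu0 /andP[d0 d1] N0 mQ Q0 S0 QE Qd Ad Sd t /andP[t0 tT].
pose q s := Q s / N; pose g s : R := `|q s - 1|.
pose b := mu * T + 3.
have T0 : 0 <= T by exact: le_trans tT.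
have muT : 0 <= mu * T by rewrite mulr_ge0// ltW.
have mulT s : s <= T -> mu * s <= mu * T by move=> sT; rewrite ler_wpM2l// ltW.
have mul0 s : 0 <= s -> 0 <= mu * s by move=> s0; rewrite mulr_ge0// ltW.
have mq : measurable_fun [set: R] q by exact: measurable_funM.
have mg : measurable_fun [set: R] g.
  by apply: measurableT_comp => //; exact: measurable_funB.
have J0 (f : R -> R) s : (forall u, 0 <= u -> 0 <= f u) ->
    0 <= \int[lebesgue_measure]_(u in `[0, s]) f u.
  by move=> f0; apply: Rintegral_ge0 => u /=; rewrite in_itv/= => /andP[/f0].
(* Dropping the departures gives [q s <= (1 + d) + (mu * s + d)], which is at most [b] because
   [d <= 1]. *)
have qb s : 0 <= s <= T -> 0 <= q s <= b.
  move=> /andP[s0 sT]; rewrite divr_ge0 ?Q0 ?(ltW N0)//= /q QE//.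
  have := Ad (mu * s); rewrite mulrA mul0//= => /(_ (mulT _ sT)).
  move: Qd; rewrite !ler_norml !mulrBl mulrDl => /andP[_ h1] /andP[_ h2].
  have : 0 <= S (mu * \int[lebesgue_measure]_(u in `[0, s]) Q u) / N.
    by rewrite divr_ge0 ?(ltW N0)// S0// mul0// J0.
  rewrite /b; move: (A _ / N) (Q 0 / N) (S _ / N) d1 (mulT _ sT) h1 h2.
  by clear=> ? ? ? ? ? ? ? ?; lra.
have les s : (lebesgue_measure (`[0%R, s]%classic : set R) < +oo)%E.
  by rewrite lebesgue_measure_itv/=; case: ifPn => // _; rewrite -EFinD ltry.
have Ic (c s : R) : 0 <= s -> \int[lebesgue_measure]_(u in `[0, s]) c = c * s.
  move=> s0; rewrite Rintegral_cst//; congr (_ * _).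
  transitivity (fine (lebesgue_measure (`[0%R, s]%classic : set R))) => //.
  rewrite lebesgue_measure_itv/= lte_fin.
  by move: s0; rewrite le_eqVlt => /predU1P[<-|->] /=; rewrite ?ltxx ?subr0.
have sub s u : s <= T -> `[0, s]%classic u -> 0 <= u <= T.
  by move=> sT /=; rewrite in_itv/= => /andP[-> us]; rewrite (le_trans us).
have int (f : R -> R) (c : R) s : s <= T -> measurable_fun [set: R] f ->
    (forall u, 0 <= u <= T -> `|f u| <= c) ->
    lebesgue_measure.-integrable `[0, s] (EFin \o f).
  move=> sT mf fc; apply: measurable_bounded_integrable => //.
  - exact: les.
  - exact: measurable_funTS.
  exists c; split; first by rewrite num_real.
  by move=> x cx u /= /(sub _ _ sT) /fc/le_trans; apply; exact: ltW.
have gb s : 0 <= s <= T -> 0 <= g s <= b.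
  move=> /qb; rewrite normr_ge0 /g ler_norml /b => /andP[]; move: (q s) muT.
  by clear=> ? ? ? ?; lra.
have iq s : s <= T -> lebesgue_measure.-integrable `[0, s] (EFin \o q).
  by move=> sT; apply: (int _ b) => // u /qb/andP[? ?]; rewrite ger0_norm.
have gI s : 0 <= s <= T ->
    g s <= 3 * d + mu * \int[lebesgue_measure]_(u in `[0, s]) g u.
  move=> /andP[s0 sT].
  pose J := \int[lebesgue_measure]_(u in `[0, s]) q u.
  have QJ : \int[lebesgue_measure]_(u in `[0, s]) Q u = N * J.
    rewrite /J -RintegralZl ?iq//; apply: eq_Rintegral => u _.
    by rewrite /q mulrC divfK// gt_eqF.
  (* This keeps [mu * J] in the interval on which [Sd] controls [S]. *)
  have Jb : 0 <= J <= T * b.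
    rewrite J0//=; last by move=> u u0; rewrite divr_ge0 ?Q0 ?(ltW N0).
    have: J <= \int[lebesgue_measure]_(u in `[0, s]) b.
      apply: le_Rintegral; rewrite ?iq//.
        by apply: (int _ `|b|).
      by move=> u /(sub _ _ sT)/qb/andP[].
    rewrite Ic// => /le_trans; apply.
    by rewrite mulrC ler_wpM2r// addr_ge0.
  have sJ : `|s - J| <= \int[lebesgue_measure]_(u in `[0, s]) g u.
    have -> : s - J = - \int[lebesgue_measure]_(u in `[0, s]) (q u - 1).
      rewrite RintegralB ?iq//; last by apply: (int _ 1) => // u _; rewrite normr1.
      by rewrite Ic// mul1r opprB.
    rewrite normrN; apply: le_normr_Rintegral => //.
    apply: (int _ b) => //; first exact: measurable_funB.
    by move=> u /gb/andP[].
  have := Sd (mu * J); rewrite mul0 /=; last by case/andP: Jb.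
  rewrite -mulrA ler_wpM2l ?(ltW mu0)//; last by case/andP: Jb.
  move=> /(_ isT) hS.
  have := Ad (mu * s); rewrite mulrA mul0//= => /(_ (mulT _ sT)) hA.
  have := ler_wpM2l (ltW mu0) sJ; rewrite -(ger0_norm (ltW mu0)) -normrM.
  rewrite (ger0_norm (ltW mu0)) => hJ.
  (* The bound follows from [q s - 1 = (q 0 - 1) + (A (N * mu * s) / N - mu * s) - (S (N * (mu * J))
     / N - mu * J) + mu * (s - J)]: three terms are at most [d] in absolute value, and [hJ] bounds
     the last one. *)
  rewrite [g s]/(`|Q s / N - 1|) QE// QJ [mu * (N * J)]mulrCA.
  move: hS hA hJ Qd; rewrite !mulrBl mulrDl mulrBr !ler_norml.
  move: (mu * J) (mu * \int[_]_(_ in _) _) (A _ / N) (Q 0 / N) (S _ / N).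
  clear=> ? ? ? ? ? /andP[? ?] /andP[? ?] /andP[? ?] /andP[? ?].
  apply/andP; split; lra.
have tI : 0 <= t <= T by rewrite t0.
have a0 : 0 <= 3 * d by rewrite mulr_ge0.
have h : `|Q t / N - 1| <= 2 * (3 * d) * expR (2 * mu * t).
  exact: (gronwall _ _ _ _ _ _ mu0 a0 mg gb gI _ tI).
rewrite (le_trans h)// mulrA -natrM; apply: ler_wpM2l; first by rewrite mulr_ge0.
by rewrite ler_expR ler_wpM2l// mulr_ge0// ltW.
Qed.

(** * Chebyshev's inequality for the Poisson law *)

Lemma poisson_pmfS (R : realType) (m : R) (k : nat) : 0 < m ->
  poisson_pmf m k.+1 * k.+1%:R = m * poisson_pmf m k.
Proof.
move=> m0; rewrite /poisson_pmf m0 factS natrM exprS invfM.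
have : k`!%:R != 0 :> R by rewrite pnatr_eq0 -lt0n fact_gt0.
have : k.+1%:R != 0 :> R by rewrite pnatr_eq0.
by move=> ? ?; field; apply/andP; split.
Qed.

(* Stein's identity [E (m f(N+1) - N f(N)) = 0], truncated at [K], for
   [f(k) = m - k]. *)
Lemma poisson_variance_sum (R : realType) (m : R) (K : nat) : 0 < m ->
  \sum_(k < K) poisson_pmf m k * (k%:R - m) ^+ 2 =
  m * \sum_(k < K) poisson_pmf m k + K%:R * poisson_pmf m K * (m - K%:R).
Proof.
move=> m0; elim: K => [|K IH]; first by rewrite !big_ord0 mulr0 !mul0r addr0.
rewrite !big_ord_recr/= IH [K.+1%:R * _]mulrC poisson_pmfS// -natr1; ring.
Qed.

(** The event is a disjoint union of fibres of [N], so its probability is a limit of partial sums of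
    the mass function. Each partial sum, multiplied by [a ^+ 2], is at most a truncated variance,
    which [poisson_variance_sum] evaluates. *)
Lemma poisson_chebyshev (R : realType) d (Omega : measurableType d)
    (P : probability Omega R) (N : Omega -> R) (m a : R) :
  measurable_fun [set: Omega] N -> (forall w, exists k : nat, N w = k%:R) ->
  (forall k : nat, P (N @^-1` [set k%:R]) = (poisson_pmf m k)%:E) ->
  0 < m -> 0 < a ->
  (P [set w | a < `|N w - m|]%R <= (m / a ^+ 2)%:E)%E.
Proof.
move=> mN Nnat Nlaw m0 a0.
have mF (k : nat) : measurable (N @^-1` [set k%:R]).
  by rewrite -[X in measurable X]setTI; exact: mN.
have tF (D : set nat) : trivIset D (fun k : nat => N @^-1` [set k%:R]).
  move=> i j _ _ [w [/= -> /eqP]].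
  by rewrite eqr_nat => /eqP.
have p0 k : 0 <= poisson_pmf m k by exact: poisson_pmf_ge0.
have sum1 K : \sum_(k < K) poisson_pmf m k <= 1.
  rewrite -lee_fin -sumEFin -(@probability_setT _ _ _ P).
  have -> : [set: Omega] = \bigcup_(k in [set: nat]) (N @^-1` [set k%:R]).
    by apply/seteqP; split => // w _; have [k Nk] := Nnat w; exists k.
  rewrite measure_bigcup//.
  under eq_eseriesl do rewrite in_setT.
  rewrite -(big_mkord xpredT (fun k => (poisson_pmf m k)%:E)).
  under eq_bigr do rewrite -Nlaw.
  by apply: nneseries_lim_ge.
pose D := [set k : nat | a < `|k%:R - m|].
have -> : [set w | a < `|N w - m|] = \bigcup_(k in D) (N @^-1` [set k%:R]).
  apply/seteqP; split => [w /= aw|w [k Dk /= ->]//].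
  by have [k Nk] := Nnat w; exists k => //; rewrite /D/= -Nk.
rewrite measure_bigcup//; apply: lime_le; first exact: is_cvg_nneseries.
near=> K.
(* From here on the boundary term [K * poisson_pmf m K * (m - K)] is nonpositive; since the partial
   masses are at most 1, the truncated variance is at most [m]. *)
have mK : m <= K%:R by near: K; exact: nbhs_infty_ger.
rewrite (eq_bigr (fun k => (poisson_pmf m k)%:E)) => [|k _]; last exact: Nlaw.
rewrite sumEFin lee_fin ler_pdivlMr ?exprn_gt0// big_mkord mulr_suml.
apply: (@le_trans _ _ (\sum_(k < K) poisson_pmf m k * (k%:R - m) ^+ 2)).
  rewrite big_mkcond/=; apply: ler_sum => k _; case: ifPn => [/set_mem|_].
    rewrite /D/= => ak; rewrite ler_wpM2l// -[leRHS]real_normK ?num_real//.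
    by rewrite lerXn2r ?nnegrE ?ltW// (lt_trans a0).
  by rewrite mulr_ge0// sqr_ge0.
rewrite poisson_variance_sum//.
have := sum1 K; have : 0 <= K%:R * poisson_pmf m K by rewrite mulr_ge0.
move: (\sum_(k < K) _) (K%:R * _) => x y; nra.
Unshelve. all: by end_near. Qed.

(* The events of interest are suprema over uncountable time sets, whose
   measurability is not at hand: hence the measurable cover [B]. *)
Definition asymptotically_sure (R : realType) (d : nat -> measure_display)
    (Omega : forall n, measurableType (d n))
    (P : forall n, probability (Omega n) R) (G : forall n, set (Omega n)) : Prop :=
  forall e : R, 0 < e -> \forall n \near \oo,
    exists B, [/\ measurable B, (P n B <= e%:E)%E & ~` B `<=` G n].

(** * Events of probability tending to 1 and the law of large numbers for Poisson processes *)

Section asymptotically_sure.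
Context {R : realType} {d : nat -> measure_display}.
Context {Omega : forall n, measurableType (d n)}.
Variable P : forall n, probability (Omega n) R.
Local Notation as_sure := (asymptotically_sure _ _ _ P).
Implicit Types G H : forall n, set (Omega n).

Lemma asymptotically_sureS G H :
  (\forall n \near \oo, G n `<=` H n) -> as_sure G -> as_sure H.
Proof.
move=> GH sG e e0; have sGe := sG e e0; near=> n.
have [B [mB PB BG]] : exists B, [/\ measurable B, (P n B <= e%:E)%E & ~` B `<=` G n].
  by near: n.
exists B; split=> //; apply: (subset_trans BG).
by near: n.
Unshelve. all: by end_near. Qed.

Lemma asymptotically_sureI G H :
  as_sure G -> as_sure H -> as_sure (fun n => G n `&` H n).
Proof.
move=> sG sH e e0; have e20 : 0 < e / 2 by rewrite divr_gt0.
have sGe := sG _ e20; have sHe := sH _ e20; near=> n.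
have [B [mB PB BG]] : exists B, [/\ measurable B, (P n B <= (e/2)%:E)%E & ~` B `<=` G n].
  by near: n.
have [C [mC PC CH]] : exists B, [/\ measurable B, (P n B <= (e/2)%:E)%E & ~` B `<=` H n].
  by near: n.
exists (B `|` C); split; first exact: measurableU.
  rewrite [e]splitr EFinD; apply: le_trans (leeD PB PC); exact: measureU2.
by rewrite setCU; apply: setISS.
Unshelve. all: by end_near. Qed.

Lemma asymptotically_sure_ae G :
  (\forall n \near \oo, \forall w \ae P n, G n w) -> as_sure G.
Proof.
move=> aG e e0; near=> n.
have [B [mB PB BG]] : \forall w \ae P n, G n w by near: n.
exists B; split=> //; first by rewrite PB lee_fin ltW.
by rewrite -[X in _ `<=` X]setCK; apply: subsetC.
Unshelve. all: by end_near. Qed.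

Lemma asymptotically_sure_forall (J : nat) (G : nat -> forall n, set (Omega n)) :
  (forall j, as_sure (G j)) ->
  as_sure (fun n => [set w | forall j, (j < J)%N -> G j n w]).
Proof.
move=> sG; elim: J => [|J IH].
  by apply: asymptotically_sure_ae; apply: nearW => n; apply: aeW.
apply: asymptotically_sureS (asymptotically_sureI _ _ IH (sG J)).
apply: nearW => n w [Gw GJ] j; rewrite ltnS leq_eqVlt => /predU1P[->//|].
exact: Gw.
Qed.

(** [N n (n * u)] has the Poisson law of mean [n * u], and Chebyshev's inequality at threshold
    [n * e] bounds the exceptional probability by [u / (n * e ^+ 2)]. The time [u = 0], where that
    mean vanishes, is settled by [poisson_start]. *)
Lemma poisson_lln (N : forall n, Omega n -> skorohod R) (u e : R) :
  (\forall n \near \oo, unit_poisson_process (P n) (N n)) -> 0 <= u -> 0 < e ->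
  as_sure (fun n => [set w | `|N n w (n%:R * u) / n%:R - u| <= e]).
Proof.
rewrite le_eqVlt => pN /predU1P[<-|u0] e0.
  apply: asymptotically_sure_ae; near=> n; apply: aeW => w /=.
  have pNn : unit_poisson_process (P n) (N n) by near: n.
  by rewrite mulr0 (poisson_start pNn) mul0r subrr normr0 ltW.
move=> eps eps0; near=> n.
have pNn : unit_poisson_process (P n) (N n) by near: n.
have n0 : 0 < n%:R :> R by near: n; exact: nbhs_infty_gtr.
have nu0 : 0 < n%:R * u by rewrite mulr_gt0.
have mN : measurable_fun setT (fun w => N n w (n%:R * u)).
  by apply: (poisson_measurable pNn); exact: ltW.
exists [set w | n%:R * e < `|N n w (n%:R * u) - n%:R * u|]; split.
- rewrite -[X in measurable X]setTI; apply: measurable_fun_ltr => //.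
  by apply: measurableT_comp => //; exact: measurable_funB.
- apply: le_trans (poisson_chebyshev _ _ _ _ _ (n%:R * u) (n%:R * e) mN _ _ nu0 _) _.
  + by move=> w; apply: (poisson_nat pNn); exact: ltW.
  + move=> k; rewrite -{2}[n%:R * u]subr0 -(poisson_law pNn)//; congr (P n _).
    by apply/seteqP; split => w; rewrite /= /increment (poisson_start pNn) subr0.
  + by rewrite mulr_gt0.
  + rewrite lee_fin ler_pdivrMr ?exprn_gt0// ?mulr_gt0//.
    have : u / (e ^+ 2 * eps) <= n%:R by near: n; exact: nbhs_infty_ger.
    rewrite ler_pdivrMr ?mulr_gt0 ?exprn_gt0// => h.
    have := ler_wpM2l (ltW n0) h; nra.
- move=> w /= /negP; rewrite -leNgt => h.
  rewrite -(ler_pM2l n0) -{1}(ger0_norm (ltW n0)) -normrM mulrBr mulrCA divff ?mulr1//.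
  by rewrite gt_eqF.
Unshelve. all: by end_near. Qed.

(** On a grid of mesh [h = e / 2] the error is at most [h] at all points simultaneously. Between
    neighbouring grid points both the path and the identity are nondecreasing, so the error grows by
    at most one mesh, to [h + h = e]. *)
Lemma poisson_lln_unif (N : forall n, Omega n -> skorohod R) (C e : R) :
  (\forall n \near \oo, unit_poisson_process (P n) (N n)) -> 0 < e ->
  as_sure (fun n => [set w | forall u, 0 <= u <= C ->
    `|N n w (n%:R * u) / n%:R - u| <= e]).
Proof.
move=> pN e0; pose h := e / 2; have h0 : 0 < h by rewrite divr_gt0.
(* One successor turns the last index into a strict bound; the other includes the grid point to the
   right of [C]. *)
pose J := (Num.truncn (C / h)).+2.
have sJ : as_sure (fun n => [set w | forall j, (j < J)%N ->
    `|N n w (n%:R * (j%:R * h)) / n%:R - j%:R * h| <= h]).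
  apply: (asymptotically_sure_forall J (fun j n =>
    [set w | `|N n w (n%:R * (j%:R * h)) / n%:R - j%:R * h| <= h])) => j.
  by apply: poisson_lln => //; rewrite mulr_ge0// ltW.
apply: asymptotically_sureS sJ; near=> n => w /= Nw u /andP[u0 uC].
have pNn : unit_poisson_process (P n) (N n) by near: n.
have n0 : 0 < n%:R :> R by near: n; exact: nbhs_infty_gtr.
pose j := Num.truncn (u / h).
have uh0 : 0 <= u / h by rewrite divr_ge0// ltW.
have /andP[ju uj] := truncn_itv uh0.
rewrite ler_pdivlMr// in ju; rewrite ltr_pdivrMr// in uj.
have jJ : (j.+1 < J)%N.
  by rewrite !ltnS; apply: le_truncn; rewrite ler_pM2r ?invr_gt0.
have nd s t : 0 <= s -> s <= t -> N n w (n%:R * s) / n%:R <= N n w (n%:R * t) / n%:R.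
  move=> s0 st; rewrite ler_pM2r ?invr_gt0//; apply: (poisson_ndecr pNn).
    by rewrite mulr_ge0// ltW.
  by rewrite ler_pM2l.
have hj := nd _ _ (mulr_ge0 (ler0n R j) (ltW h0)) ju.
have hj1 := nd _ _ u0 (ltW uj).
have := Nw _ (ltnW jJ); have := Nw _ jJ.
rewrite -natr1 mulrDl mul1r in uj hj1 *.
have -> : e = h + h by rewrite -splitr.
rewrite !ler_norml; move: hj hj1 uj ju.
move: (j%:R * h) (N n w _ / _) (N n w _ / _) (N n w _ / _).
clear=> ? ? ? ?; move=> ? ? ? ? /andP[? ?] /andP[? ?]; apply/andP; split; lra.
Unshelve. all: by end_near. Qed.

End asymptotically_sure.

(** * Expectations of bounded functions and convergence in distribution *)

Section bounded_expectation.
Context {R : realType} {d : measure_display} {Omega : measurableType d}.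
Variable P : probability Omega R.

Lemma random_element_comp (T : ptopologicalType) (X : Omega -> T) (f : T -> R) :
  random_element X -> continuous f -> measurable_fun [set: Omega] (f \o X).
Proof.
move=> mX /continuousP cf; apply: (measurability _ (RGenOpens.measurableE R)).
move=> _ [_ [a [b ->] <-]]; rewrite setTI comp_preimage.
rewrite -[X in measurable X]setTI; apply: mX => //.
by apply: sub_sigma_algebra; exact/cf/interval_open.
Qed.

Lemma bounded_integrable (g : Omega -> R) (M : R) :
  measurable_fun [set: Omega] g -> (forall w, `|g w| <= M) ->
  P.-integrable setT (EFin \o g).
Proof.
move=> mg gM; apply: measurable_bounded_integrable => //.
  exact: le_lt_trans (probability_le1 P measurableT) (ltry _).
exists M; split; first by rewrite num_real.
by move=> x Mx w _ /=; rewrite (le_trans (gM w))// ltW.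
Qed.

Lemma expectation_Rintegral (g : Omega -> R) (M : R) :
  measurable_fun [set: Omega] g -> (forall w, `|g w| <= M) ->
  ('E_P[g])%E = (\int[P]_w g w)%:E.
Proof.
move=> mg gM; rewrite unlock /Rintegral fineK//.
by apply: integrable_fin_num => //; exact: bounded_integrable gM.
Qed.

(** Pointwise [|g - c| <= e + 2 * M * \1_B]: the first term serves off [B], the trivial bound
    [2 * M] on [B]. Integrating gives the claim. *)
Lemma expectation_close (g : Omega -> R) (M c e h : R) (B : set Omega) :
  measurable_fun [set: Omega] g -> (forall w, `|g w| <= M) -> `|c| <= M ->
  measurable B -> (P B <= h%:E)%E -> 0 <= e ->
  (forall w, ~ B w -> `|g w - c| <= e) ->
  `|\int[P]_w g w - c| <= e + 2 * M * h.
Proof.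
move=> mg gM cM mB PB e0 gc.
have M0 : 0 <= M by exact: le_trans (normr_ge0 c) cM.
have ig := bounded_integrable _ _ mg gM.
have ic (x : R) : P.-integrable setT (EFin \o (fun=> x)).
  by apply: (bounded_integrable _ `|x|).
have iB : P.-integrable setT (EFin \o \1_B).
  apply: (bounded_integrable _ 1) => // w; rewrite indicE.
  by case: (_ \in _); rewrite ?normr0 ?normr1.
have intB : \int[P]_w \1_B w <= h.
  rewrite /Rintegral integral_indic// setIT -lee_fin fineK//.
  by rewrite fin_num_measure.
have Ic (x : R) : \int[P]_w x = x.
  rewrite Rintegral_cst// -[RHS]mulr1; congr (_ * _).
  exact: (congr1 fine (probability_setT P)).
rewrite -{1}(Ic c) -RintegralB//.
have mgc : measurable_fun [set: Omega] (fun w => g w - c) by exact: measurable_funB.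
have gcM w : `|g w - c| <= 2 * M.
  by rewrite (le_trans (ler_normB _ _))// mulr_natl mulr2n lerD.
apply: (le_trans (le_normr_Rintegral _ _)) => //.
  exact: bounded_integrable gcM.
apply: (@le_trans _ _ (\int[P]_w (e + 2 * M * \1_B w))).
  apply: le_Rintegral => //.
  - apply: (bounded_integrable _ (2 * M)) => [|w]; last by rewrite normr_id.
    by apply: measurableT_comp.
  - apply: (bounded_integrable _ (e + 2 * M)) => [|w].
      by apply: measurable_funD => //; apply: measurable_funM.
    rewrite ger0_norm ?addr_ge0 ?mulr_ge0// lerD2l.
    by rewrite ler_piMr ?mulr_ge0// indicE; case: (_ \in _).
  - move=> w _; rewrite indicE; case: (boolP (w \in B)) => [_|/negP wB].
      by rewrite mulr1 (le_trans (gcM w))// lerDr.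
    by rewrite mulr0 addr0 gc// => Bw; apply: wB; exact/mem_set.
have i2 : P.-integrable setT (EFin \o (fun w => 2 * M * \1_B w)).
  exact: (integrableZl measurableT _ iB).
by rewrite RintegralD// RintegralZl// Ic lerD2l ler_wpM2l ?mulr_ge0.
Qed.

End bounded_expectation.

(** For a constant limit, convergence in probability is enough. A bounded continuous [f] is within
    [e / 2] of [f c] on an open neighbourhood of [c], and the complementary event has small
    probability, so [expectation_close] applies. *)
Lemma cvg_in_distribution_cst (R : realType) (T : ptopologicalType)
    (d : nat -> measure_display) (Omega : forall n, measurableType (d n))
    (P : forall n, probability (Omega n) R) (X : forall n, Omega n -> T)
    (d' : measure_display) (Omega' : measurableType d')
    (P' : probability Omega' R) (c : T) :
  (\forall n \near \oo, random_element (X n)) ->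
  (forall U, open U -> U c ->
    asymptotically_sure R d Omega P (fun n => X n @^-1` U)) ->
  cvg_in_distribution P X P' (fun=> c).
Proof.
move=> mX cX; split=> //.
  move=> _ B mB; rewrite setTI; have [Bc|nBc] := pselect (B c).
    by rewrite (_ : _ @^-1` _ = setT)//; apply/seteqP; split.
  by rewrite (_ : _ @^-1` _ = set0)//; apply/seteqP; split.
move=> f cf [M0 [_ /(_ (`|M0| + 1))]].
rewrite (le_lt_trans (ler_norm _)) ?ltrDl// => /(_ isT) fM.
have {}fM x : `|f x| <= `|M0| + 1 by apply: fM.
set M := `|M0| + 1 in fM.
have M0' : 0 < M by rewrite ltr_wpDl.
have -> : ('E_P'[f \o (fun=> c)])%E = (f c)%:E by rewrite -(expectation_cst P').
apply/fine_cvgP; split.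
  near=> n; have mXn : random_element (X n) by near: n.
  by rewrite (expectation_Rintegral _ _ M)//=; exact: random_element_comp.
apply/cvgrPdist_le => e e0.
(* Chosen so that [2 * M * h = e / 2]. *)
pose h := e / (4 * M); have h0 : 0 < h by rewrite divr_gt0// mulr_gt0.
have oU : open (f @^-1` ball (f c) (e / 2)).
  by move/continuousP : cf; apply; exact: ball_open.
have cU := cX _ oU (ballxx _ _); rewrite divr_gt0// in cU.
have {cU oU} /= sU := cU isT h h0.
near=> n; have mXn : random_element (X n) by near: n.
have [B [mB PB BU]] : exists B, [/\ measurable B, (P n B <= h%:E)%E &
  ~` B `<=` X n @^-1` (f @^-1` ball (f c) (e / 2))] by near: n.
have mf : measurable_fun setT (f \o X n) by exact: random_element_comp.
rewrite /= (expectation_Rintegral _ _ M)//= distrC.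
have -> : e = e / 2 + 2 * M * h by rewrite /h; field; rewrite gt_eqF.
apply: (expectation_close (P n) (f \o X n) M _ _ _ B) => //.
- by move=> w; exact: fM.
- by rewrite divr_ge0// ltW.
by move=> w /BU; rewrite /ball/= distrC => /ltW.
Unshelve. all: by end_near. Qed.

(** The test function [f k] vanishes for [|x| <= k] and equals 1 for [|x| >= k + 1]. By dominated
    convergence some [k] makes the expectation of [f k \o X] smaller than [e]; this passes to [Y n]
    for large [n], and there it dominates the probability of [|Y n| > k + 1]. *)
Lemma cvg_in_distribution_tight (R : realType)
    (d : nat -> measure_display) (Omega : forall n, measurableType (d n))
    (P : forall n, probability (Omega n) R) (Y : forall n, Omega n -> R)
    (d' : measure_display) (Omega' : measurableType d')
    (P' : probability Omega' R) (X : {RV P' >-> R}) (e : R) :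
  cvg_in_distribution (T := R) P Y P' X -> 0 < e ->
  exists K : R, \forall n \near \oo,
    exists B, [/\ measurable B, (P n B <= e%:E)%E &
      ~` B `<=` [set w | `|Y n w| <= K]].
Proof.
move=> [mY _ cY] e0.
pose f (k : nat) (x : R) : R := Num.min 1 (Num.max 0 (`|x| - k%:R)).
have f01 k x : 0 <= f k x <= 1.
  by rewrite /f le_min ler01 le_max lexx/= ge_min lexx.
have f1 k x : `|f k x| <= 1 by have /andP[? ?] := f01 k x; rewrite ger0_norm.
have cf k : continuous (f k).
  move=> x; apply: (@continuous_min _ _ (fun=> 1) _ x); first exact: cvg_cst.
  apply: (@continuous_max _ _ (fun=> 0) _ x); first exact: cvg_cst.
  apply: cvgB; last exact: cvg_cst.
  by apply: cvg_norm; exact: cvg_id.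
have mfX k : measurable_fun setT (f k \o X).
  by apply: measurableT_comp => //; exact: continuous_measurable_fun.
have fX0 : (\int[P']_w (f k (X w))%:E @[k --> \oo] --> \int[P']_w (cst 0%E w))%E.
  apply: (@dominated_cvg _ _ _ _ _ _ _ _ (cst 1%E)) => //.
  - by move=> k; apply/measurable_EFinP; exact: mfX.
  - move=> w _; apply: cvg_near_cst; near=> k; congr EFin.
    rewrite /f max_l ?min_r// subr_le0; near: k; exact: nbhs_infty_ger.
  - by apply: (bounded_integrable P' (cst 1) 1) => // w; rewrite normr1.
  - by move=> k w _; rewrite lee_fin.
rewrite integral0 in fX0.
have [k fXk] : exists k, (\int[P']_w (f k (X w))%:E < e%:E)%E.
  have [k _ /(_ k (leqnn k))] : \forall k \near \oo, (\int[P']_w (f k (X w))%:E < e%:E)%E.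
    exact: (fX0 _ (@nbhs_open_ereal_lt R 0 (fun=> e) e0)).
  by exists k.
exists (k%:R + 1).
have bf : bounded_fun (f k).
  exists 1; split; first by rewrite num_real.
  by move=> x x1 y _; rewrite /= (le_trans (f1 _ _))// ltW.
have cE := cY _ (cf k) bf.
have EX := expectation_Rintegral P' _ _ (mfX k) (fun w => f1 k (X w)).
rewrite unlock in cE EX; rewrite EX in cE.
have re : \int[P']_w (f k \o X) w < e by rewrite -lte_fin -EX.
have lE := cE _ (@nbhs_open_ereal_lt R _ (fun=> e) re).
near=> n.
have mYn : random_element (Y n : Omega n -> R) by near: n.
have mfY : measurable_fun setT (f k \o Y n) by exact: random_element_comp.
have mYn' : measurable_fun setT (Y n).
  by apply: (random_element_comp R (Y n) idfun) => // x; exact: cvg_id.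
have lEn : (\int[P n]_w (f k (Y n w))%:E < e%:E)%E by near: n.
have mB : measurable [set w | k%:R + 1 < `|Y n w|].
  rewrite -[X in measurable X]setTI; apply: measurable_fun_ltr => //.
  exact: measurableT_comp.
exists [set w | k%:R + 1 < `|Y n w|]; split => //.
- apply: le_trans (ltW lEn).
  rewrite -[X in P n X]setIT -integral_indic//; apply: ge0_le_integral => //.
  + by apply/measurable_EFinP; exact: measurable_indic.
  + by apply/measurable_EFinP.
  + move=> w _; rewrite lee_fin indicE.
    case: (boolP (w \in _)) => [/set_mem/= kY|_]; last by have /andP[] := f01 k (Y n w).
    by rewrite /f max_r ?min_l//; lra.
- by move=> w /= /negP; rewrite -leNgt.
Unshelve. all: by end_near. Qed.

(** * Scaling and uniform closeness in the J1 topology *)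

Lemma J1_openE (R : realType) (U : set (skorohod R)) : open U = J1_open U.
Proof. by []. Qed.

Lemma skorohod_scale_continuous (R : realType) (c : R) :
  continuous (skorohod_scale c).
Proof.
apply/continuousP => U oU; rewrite J1_openE => x Ux.
rewrite J1_openE in oU.
have [T [e [e0 TeU]]] := oU _ Ux.
have c0 : 0 < `|c| + 1 by rewrite ltr_wpDl.
(* Scaling leaves the time change untouched, whence the bound [e]; the space error is multiplied by
   [|c|], and the added 1 covers [c = 0]. *)
exists T, (Num.min e (e / (`|c| + 1))); split; first by rewrite lt_min e0 divr_gt0.
move=> y [lam lamP xy]; apply: TeU; exists lam => // s /xy[].
rewrite !lt_min => /andP[-> _] /andP[_ yx]; split=> //=.
rewrite -mulrBr normrM.
rewrite ltr_pdivlMr// in yx; rewrite (le_lt_trans _ yx)// mulrC.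
by rewrite ler_wpM2l// lerDl.
Qed.

Lemma random_element_continuous (d : measure_display) (Omega : measurableType d)
    (T U : ptopologicalType) (X : Omega -> T) (f : T -> U) :
  random_element X -> continuous f -> random_element (f \o X).
Proof.
move=> mX /continuousP cf.
apply: (@measurability _ _ Omega (borel U) setT (f \o X) open) => //.
move=> _ [B oB <-]; rewrite setTI comp_preimage.
rewrite -[X in measurable X]setTI; apply: mX => //.
by apply: sub_sigma_algebra; exact: cf.
Qed.

(** The identity is a time change, so uniform closeness on [[0, T]] is J1 closeness. *)
Lemma J1_near_uniform (R : realType) (T e : R) (x y : skorohod R) : 0 < e ->
  (forall t, 0 <= t <= T -> `|y t - x t| < e) -> J1_near T e x y.
Proof.
move=> e0 xy; exists id.
  by split=> //; split=> // t t0; exists t.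
by move=> s sT; rewrite subrr normr0; split=> //; exact: xy.
Qed.

(** * The fluid limit of the queue *)

Section MMoo_fluid_limit.
Context {R : realType} {d : nat -> measure_display}.
Context {Omega : forall n, measurableType (d n)}.
Context (P : forall n, probability (Omega n) R) (mu : R).
Context (Q : forall n, Omega n -> skorohod R).
Context (mu_gt0 : 0 < mu).
Context (queue_Q :
  forall n, (1 <= n)%N -> MMoo_queue (P n) (n%:R * mu) mu (Q n)).

(** The deviation is the normalised initial value divided by [sqrt n]. Tightness bounds the
    numerator by some [K], and [K / sqrt n <= e] as soon as [n >= (K / e) ^+ 2]. *)
Lemma initial_lln (d' : measure_display) (Omega' : measurableType d')
    (P' : probability Omega' R) (X0 : {RV P' >-> R}) (e : R) :
  cvg_in_distribution (T := R) P
    (fun n w => (Q n w 0 - n%:R) / Num.sqrt n%:R) P' X0 ->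
  0 < e ->
  asymptotically_sure R d Omega P
    (fun n => [set w | `|Q n w 0 / n%:R - 1| <= e]).
Proof.
move=> cQ0 e0 eps eps0.
have [K nK] := cvg_in_distribution_tight _ _ _ _ _ _ _ _ _ _ cQ0 eps0.
near=> n.
have [B [mB PB BK]] : exists B, [/\ measurable B, (P n B <= eps%:E)%E &
    ~` B `<=` [set w | `|(Q n w 0 - n%:R) / Num.sqrt n%:R| <= K]] by near: n.
exists B; split=> // w /BK /= QK.
have n0 : 0 < n%:R :> R by near: n; exact: nbhs_infty_gtr.
have sn0 : 0 < Num.sqrt n%:R :> R by rewrite sqrtr_gt0.
have -> : Q n w 0 / n%:R - 1 = (Q n w 0 - n%:R) / Num.sqrt n%:R / Num.sqrt n%:R.
  rewrite -mulrA -invfM -expr2 sqr_sqrtr ?ltW// mulrBl divff//.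
  by rewrite gt_eqF.
rewrite normrM (gtr0_norm (_ : 0 < (Num.sqrt n%:R)^-1)) ?invr_gt0//.
rewrite ler_pdivrMr// (le_trans QK)// mulrC -ler_pdivrMr//.
rewrite (le_trans (ler_norm _))// -sqrtr_sqr ler_wsqrtr//.
by near: n; exact: nbhs_infty_ger.
Unshelve. all: by end_near. Qed.

Lemma MMoo_uniform_lln (d' : measure_display) (Omega' : measurableType d')
    (P' : probability Omega' R) (X0 : {RV P' >-> R}) (T e : R) :
  cvg_in_distribution (T := R) P
    (fun n w => (Q n w 0 - n%:R) / Num.sqrt n%:R) P' X0 ->
  0 < e ->
  asymptotically_sure R d Omega P (fun n => [set w |
    forall t, 0 <= t <= T -> `|Q n w t / n%:R - 1| < e]).
Proof.
move=> cQ0 e0.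
pose E := expR (2 * mu * T); have E0 : 0 < E by exact: expR_gt0.
(* The 1 meets the condition [d <= 1] of [fluid_deviation]; 7 in place of its constant 6 makes the
   final inequality strict. *)
pose h := Num.min 1 (e / (7 * E)).
have h0 : 0 < h by rewrite lt_min ltr01 divr_gt0// mulr_gt0.
have hE : 6 * h * E < e.
  have : h <= e / (7 * E) by rewrite ge_min lexx orbT.
  rewrite ler_pdivlMr ?mulr_gt0//; nra.
(* The driving processes exist separately for each [n]; choosing them as sequences needs a value at
   [n = 0] too, where the zero path is a placeholder. *)
have driving n : exists AS : (Omega n -> skorohod R) * (Omega n -> skorohod R),
    (1 <= n)%N -> [/\ unit_poisson_process (P n) AS.1,
      unit_poisson_process (P n) AS.2 &
      \forall w \ae P n, forall t, 0 <= t ->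
        Q n w t = Q n w 0 + AS.1 w (n%:R * mu * t)
          - AS.2 w (mu * \int[lebesgue_measure]_(s in `[0, t]) Q n w s)].
  have [n0|] := leqP 1 n; last by exists (fun=> skorohod_cst 0, fun=> skorohod_cst 0).
  by have [_ _ [A [S [pA pS _ QE]]]] := queue_Q _ n0; exists (A, S).
pose A n := (projT1 (cid (driving n))).1.
pose S n := (projT1 (cid (driving n))).2.
have AS n : (1 <= n)%N -> _ := projT2 (cid (driving n)).
have pA : \forall n \near \oo, unit_poisson_process (P n) (A n).
  by exists 1%N => // n /= /AS[].
have pS : \forall n \near \oo, unit_poisson_process (P n) (S n).
  by exists 1%N => // n /= /AS[].
have QE : \forall n \near \oo, \forall w \ae P n, forall t, 0 <= t ->
    Q n w t = Q n w 0 + A n w (n%:R * mu * t)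
      - S n w (mu * \int[lebesgue_measure]_(s in `[0, t]) Q n w s).
  by exists 1%N => // n /= /AS[].
apply: asymptotically_sureS; last first.
  apply: asymptotically_sureI (asymptotically_sure_ae _ _ QE) _.
  apply: asymptotically_sureI (initial_lln _ _ _ _ _ cQ0 h0) _.
  apply: asymptotically_sureI (poisson_lln_unif P A (mu * T) h pA h0) _.
  exact: (poisson_lln_unif P S (mu * T * (mu * T + 3)) h pS h0).
near=> n => w /= [QEw [Q0w [Aw Sw]]] t tT.
have n0 : 0 < n%:R :> R by near: n; exact: nbhs_infty_gtr.
have pSn : unit_poisson_process (P n) (S n) by near: n.
have [_ Qnat _] : MMoo_queue (P n) (n%:R * mu) mu (Q n).
  by apply: queue_Q; rewrite -(ltr0n R).
apply: le_lt_trans hE.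
apply: (fluid_deviation _ _ _ _ n%:R _ (A n w) (S n w)) => //.
- by rewrite ltW//= ge_min lexx.
- by apply: cadlag_measurable; exact: skorohod_cadlag.
- by move=> s /(Qnat w)[k ->].
- move=> u u0; rewrite -(poisson_start pSn w).
  exact: (poisson_ndecr pSn).
Unshelve. all: by end_near. Qed.

End MMoo_fluid_limit.

Theorem lemma4p3 (R : realType) (mu : R) (mu_gt0 : 0 < mu)
    (d : nat -> measure_display) (Omega : forall n, measurableType (d n))
    (P : forall n, probability (Omega n) R)
    (Q : forall n, Omega n -> skorohod R)
    (queue_Q : forall n, (1 <= n)%N ->
       MMoo_queue (P n) (n%:R * mu) mu (Q n))
    (d' : measure_display) (Omega' : measurableType d')
    (P' : probability Omega' R) (X0 : {RV P' >-> R})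
    (cvg_Q0 : cvg_in_distribution (T := R) P
       (fun n w => (Q n w 0 - n%:R) / Num.sqrt n%:R) P' X0) :
  cvg_in_distribution P (fun n w => skorohod_scale n%:R^-1 (Q n w))
    P' (fun=> skorohod_cst 1).
Proof.
apply: cvg_in_distribution_cst => [|U oU U1].
  exists 1%N => // n /= /queue_Q[mQ _ _].
  apply: (random_element_continuous _ _ _ _ (Q n)) => //.
  exact: skorohod_scale_continuous.
(* A basic neighbourhood of the constant path constrains times up to some [T] only, so the uniform
   estimate on [[0, T]] suffices. *)
rewrite J1_openE in oU; have [T [e [e0 TeU]]] := oU _ U1.
apply: asymptotically_sureS (MMoo_uniform_lln _ _ _ mu_gt0 queue_Q _ _ _ _ T e cvg_Q0 e0).
apply: nearW => n w /= Qw; apply: TeU; apply: J1_near_uniform => // t tT /=.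
by rewrite mulrC; exact: Qw.
Qed.
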